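(* Let $(X,T)$ be a topological dynamical system and $A=(a_{ij})_{1\le i,j\le p}$ a transition matrix, $p\ge2$. If the map $T:X\to X$ is strictly $A$-coupled-expanding in $\Lambda_1,\dots,\Lambda_p\subset X$, then $h_{top}(X,T)\ge\log\lambda_A$.
   Context: A topological dynamical system $(X,T)$ is a compact metric space $X$ with metric $d$ together with a surjective continuous map $T:X\to X$; $h_{top}(X,T)$ is its topological entropy (defined via finite open covers). A $p\times p$ matrix $A=(a_{ij})$ is a transition matrix if all $a_{ij}\in\{0,1\}$ and every row sum and every column sum is at least $1$. $\lambda_A$ denotes the maximal eigenvalue of $A$, i.e. the (nonnegative real) eigenvalue with $|\mu|\le\lambda_A$ for every eigenvalue $\mu$ of $A$ (the spectral radius of $A$). For $p\ge2$, $T$ is $A$-coupled-expanding in nonempty subsets $\Lambda_1,\dots,\Lambda_p$ of $X$ with pairwise disjoint interiors if $T(\Lambda_i)\supset\bigcup_{j:\,a_{ij}=1}\Lambda_j$ for all $1\le i\le p$; it is strictly $A$-coupled-expanding if moreover $d(\Lambda_i,\Lambda_j)=\inf\{d(x,y):x\in\Lambda_i,y\in\Lambda_j\}>0$ for all $i\ne j$. *)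

(* Defs.v *)
From HB Require Import structures.
From mathcomp Require Export all_boot all_order all_algebra.
From mathcomp Require Export all_classical all_reals all_analysis.
From mathcomp Require Export complex.
Export Order.TTheory GRing.Theory Num.Theory numFieldNormedType.Exports.

Set Implicit Arguments.
Unset Strict Implicit.
Unset Printing Implicit Defensive.

Local Open Scope classical_set_scope.
Local Open Scope ring_scope.

Section TopologicalEntropy.
Context {R : realType} {X : metricType R}.
Implicit Types (T : X -> X) (U V : set (set X)).

Definition topological_dynamical_system T : Prop :=
  [/\ compact [set: X], continuous T & range T = [set: X]].

Definition is_cover U : Prop := \bigcup_(B in U) B = [set: X].

Definition finite_open_cover U : Prop :=
  [/\ finite_set U, (forall B, U B -> open B) & is_cover U].

Definition has_subcover U (k : nat) : Prop :=
  exists V, [/\ V `<=` U, is_cover V & (V #= `I_k)%card].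

(* The default value 0 is only reached when U has no finite subcover. *)
Definition min_subcover U : nat :=
  xget 0%N [set k | has_subcover U k /\
                    forall l, has_subcover U l -> (k <= l)%N].

(* U \/ T^-1 U \/ ... \/ T^-(n-1) U *)
Definition dynamical_join T U (n : nat) : set (set X) :=
  [set B | exists2 s : 'I_n -> set X, forall i, U (s i) &
           B = \bigcap_(i in [set: 'I_n]) (iter i T @^-1` s i)].

(* By subadditivity (Fekete) the limit exists for every finite open cover of
   a continuous map; the term of index 0 is 0 since division by 0 yields 0. *)
Definition entropy_cover T U : R :=
  limn (fun n => ln (min_subcover (dynamical_join T U n))%:R / n%:R).

Definition topological_entropy T : \bar R :=
  ereal_sup [set (entropy_cover T U)%:E | U in finite_open_cover].

End TopologicalEntropy.

Section TransitionMatrix.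
Context {R : realType} {p : nat}.
Implicit Types A : 'M[R]_p.

Definition transition_matrix A : Prop :=
  [/\ forall i j, A i j = 0 \/ A i j = 1,
      forall i, 1 <= \sum_j A i j &
      forall j, 1 <= \sum_i A i j].

(* Eigenvalues are taken in R[i]. Such a lam is unique, and exists for every
   matrix with nonnegative entries when p > 0 (Perron-Frobenius). *)
Definition is_maximal_eigenvalue A (lam : R) : Prop :=
  let AC := map_mx (real_complex R) A in
  [/\ 0 <= lam,
      eigenvalue AC (real_complex R lam) &
      forall mu : R[i], eigenvalue AC mu -> `|mu| <= real_complex R lam].

End TransitionMatrix.

Section CoupledExpansion.
Context {R : realType} {X : metricType R} {p : nat}.
Implicit Types (T : X -> X) (A : 'M[R]_p) (L : 'I_p -> set X).

Definition set_dist (B C : set X) : R := inf [set mdist x y | x in B & y in C].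

Definition coupled_expanding T A L : Prop :=
  [/\ forall i, L i !=set0,
      forall i j, i != j -> (L i)° `&` (L j)° = set0 &
      forall i, \bigcup_(j in [set j | A i j = 1]) L j `<=` T @` L i].

Definition strictly_coupled_expanding T A L : Prop :=
  coupled_expanding T A L /\ forall i j, i != j -> 0 < set_dist (L i) (L j).

End CoupledExpansion.

(* Main.v *)
Require Import Defs.
From mathcomp Require Import lra.

(** Let [N n] be the least number of members of the [n]-th dynamical join of a
finite open cover [U] that still cover [X]. Lemma [entropy_cover_ge] turns a
bound [lam ^ n <= N n.+1] into [ln lam <= entropy_cover T U], so it is enough
to find one cover [U] for which [N] grows that fast. When [lam < 1], the inequality
is trivial because entropy is nonnegative and [ln lam <= 0].

The sets [L i] are at positive distance from each other, so their closures are
disjoint. The complements of the unions of all closures but one then form a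
finite open cover each of whose members meets at most one [L i]
([separating_cover]). For this cover, a member of the join of length [n.+1]
determines the itinerary of length [n.+1] of any of its points that stays in
the [L i]. Since [T] maps [L i] onto every [L j] with [A i j = 1], every path
of length [n] in the graph of [A] is such an itinerary, so [N n.+1] is at least
the number of paths of length [n] from any given vertex
([path_count_le_cover]).

Finally the numbers of paths grow at least like the powers of any eigenvalue:
weighting the vertices by the absolute values [|v i|] of a left eigenvector, the
weighted number of paths is multiplied by at least [|lam|] at each step
([eigenvalue_path_count]).

The entropy of a cover is defined as a limit, about which nothing can be said
before it is known to exist. This is Fekete's lemma ([fekete_nneg]), applied to
[ln (N n)], which is subadditive because joins of lengths [m] and [n] combine
into the join of length [m + n] ([min_subcover_joinD]). *)

Set Implicit Arguments.
Unset Strict Implicit.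
Unset Printing Implicit Defensive.

Local Open Scope classical_set_scope.
Local Open Scope ring_scope.

(** * Indexed subcovers *)

(** Subcovers are handled as indexed families, repetitions being allowed: then
restricting a family or combining two families involves no computation of the
cardinality of a set of sets. *)
Definition covers_by {X I : Type} (U : set (set X)) (f : I -> set X) : Prop :=
  (forall i, U (f i)) /\ (forall x, exists i, f i x).

Lemma card_cover_family (X : Type) (V : set (set X)) (k : nat) :
  (V #= `I_k)%card -> \bigcup_(B in V) B = [set: X] ->
  exists g : 'I_k -> set X, covers_by V g.
Proof.
rewrite card_eq_sym (card_eql card_II) => /card_set_bijP[g gbij] coverV.
exists g; split=> [i|x]; first by case: gbij => + _ _; apply.
have : [set: X] x by [].
rewrite -coverV => -[B VB Bx]; have [_ _ /(_ B VB)[i _ giB]] := gbij.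
by exists i; rewrite giB.
Qed.

Lemma has_subcover_family (R : realType) (X : metricType R) (U : set (set X))
    (I : finType) (f : I -> set X) :
  covers_by U f -> exists2 k, (k <= #|I|)%N & has_subcover U k.
Proof.
move=> [Uf coverf]; pose g (i : 'I_#|I|) := f (enum_val i).
have rangeg : (range g #<= `I_#|I|)%card.
  by rewrite (card_le_eqr card_II) card_image_le.
have [k gk] : finite_set (range g).
  by apply: finite_image; exact: finite_finset.
exists k; first by rewrite -card_le_II -(card_le_eql gk).
exists (range g); split => //; first by move=> _ [i _ <-]; exact: Uf.
rewrite /is_cover; apply/seteqP; split => // x _.
have [i fix_] := coverf x; exists (f i) => //.
by exists (enum_rank i) => //; rewrite /g enum_rankK.
Qed.

Lemma min_subcoverP (R : realType) (X : metricType R) (U : set (set X)) k :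
  has_subcover U k -> has_subcover U (min_subcover U) /\
    (forall l, has_subcover U l -> (min_subcover U <= l)%N).
Proof.
move=> Uk; apply: (@xgetPex _ _ [set k | has_subcover U k /\ _]).
have /ex_minnP[m /asboolP Um minm] : exists n, `[<has_subcover U n>].
  by exists k; apply/asboolP.
by exists m; split=> // l Ul; apply/minm/asboolP.
Qed.

Lemma min_subcover_le (R : realType) (X : metricType R) (U : set (set X))
    (I : finType) (f : I -> set X) :
  covers_by U f -> (min_subcover U <= #|I|)%N.
Proof.
move=> /has_subcover_family[k kI Uk]; apply: leq_trans kI.
by have [_ /(_ _ Uk)] := min_subcoverP Uk.
Qed.

Lemma min_subcover_family (R : realType) (X : metricType R) (U : set (set X))
    (I : finType) (f : I -> set X) :
  covers_by U f -> exists g : 'I_(min_subcover U) -> set X, covers_by U g.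
Proof.
move=> /has_subcover_family[k _ /min_subcoverP[[V [VU coverV VN]] _]].
have [g [Vg coverg]] := card_cover_family VN coverV.
by exists g; split=> // i; exact: VU.
Qed.

(** * Dynamical joins *)

(** Letting the sequence of chosen members run over all of [nat] makes it
possible to shift and concatenate such sequences without casts. *)
Lemma dynamical_joinE (R : realType) (X : metricType R) (T : X -> X)
    (U : set (set X)) (n : nat) :
  dynamical_join T U n =
  [set B | exists2 s : nat -> set X, forall i, (i < n)%N -> U (s i) &
           B = [set x | forall i, (i < n)%N -> s i (iter i T x)]].
Proof.
apply/seteqP; split=> B [s Us ->].
  exists (fun i => if insub i is Some j then s j else set0).
    by move=> i ltin; rewrite insubT.
  apply/seteqP; split=> x sx i.
    by move=> ltin; rewrite insubT; exact: (sx (Ordinal ltin)).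
  by have := sx i (ltn_ord i); rewrite valK.
exists (fun i : 'I_n => s i); first by move=> i; apply: Us.
apply/seteqP; split=> x sx i; first by move=> _; exact: sx.
by move=> ltin; exact: (sx (Ordinal ltin)).
Qed.

Lemma dynamical_joinD (R : realType) (X : metricType R) (T : X -> X)
    (U : set (set X)) (m n : nat) :
  dynamical_join T U (m + n) =
  [set B `&` iter m T @^-1` C |
    B in dynamical_join T U m & C in dynamical_join T U n].
Proof.
rewrite !dynamical_joinE; apply/seteqP; split=> [B [s Us ->]|].
  exists [set x | forall i, (i < m)%N -> s i (iter i T x)].
    by exists s => // i im; apply: Us; rewrite ltn_addr.
  exists [set x | forall i, (i < n)%N -> s (m + i)%N (iter i T x)].
    by exists (fun i => s (m + i)%N) => // i ni; apply: Us; rewrite ltn_add2l.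
  apply/seteqP; split=> x /= => [[sm sn] i imn|sx].
    have [|lemi] := ltnP i m; first exact: sm.
    rewrite -(subnKC lemi) (addnC m) iterD -(addnC m); apply: sn.
    by rewrite ltn_subLR.
  split=> i ilt; first by apply: sx; rewrite ltn_addr.
  by rewrite -iterD (addnC i); apply: sx; rewrite ltn_add2l.
move=> _ [_ [s Us ->] [_ [t Ut ->]] <-].
exists (fun i => if (i < m)%N then s i else t (i - m)%N).
  move=> i imn; case: ltnP => [|mi]; first exact: Us.
  by apply: Ut; rewrite ltn_subLR.
apply/seteqP; split=> x /= => [[sm sn] i imn|sx].
  case: ltnP => [|mi]; first exact: sm.
  rewrite -{2}(subnK mi) iterD; apply: sn.
  by rewrite ltn_subLR.
split=> i ilt; first by have := sx i; rewrite ltn_addr ?ilt//; apply.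
have := sx (m + i)%N.
rewrite ltn_add2l addKn (ltnNge (m + i)) leq_addr /= => /(_ ilt).
by rewrite -iterD (addnC i).
Qed.

Lemma dynamical_join1 (R : realType) (X : metricType R) (T : X -> X)
    (U : set (set X)) : dynamical_join T U 1 = U.
Proof.
rewrite dynamical_joinE; apply/seteqP; split=> [_ [s Us ->]|B UB].
  rewrite (_ : [set _ | _] = s 0%N); first exact: Us.
  by apply/seteqP; split=> x /= sx; [exact: (sx 0%N)|case].
exists (fun=> B) => //.
by apply/seteqP; split=> x /= Bx; [case|exact: (Bx 0%N)].
Qed.

Lemma dynamical_join0 (R : realType) (X : metricType R) (T : X -> X)
    (U : set (set X)) : dynamical_join T U 0 = [set setT].
Proof.
rewrite dynamical_joinE; apply/seteqP; split=> [_ [s Us ->]|_ ->]/=.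
  by apply/seteqP; split.
by exists (fun=> setT) => //; apply/seteqP; split.
Qed.

Lemma covers_by_joinD (R : realType) (X : metricType R) (T : X -> X)
    (U : set (set X)) (m n : nat) (I J : Type)
    (f : I -> set X) (g : J -> set X) :
  covers_by (dynamical_join T U m) f -> covers_by (dynamical_join T U n) g ->
  covers_by (dynamical_join T U (m + n))
    (fun ij : I * J => f ij.1 `&` iter m T @^-1` g ij.2).
Proof.
move=> [Uf coverf] [Ug coverg]; split=> [[i j]|x] /=.
  by rewrite dynamical_joinD; exists (f i) => //; exists (g j).
have [i fi] := coverf x; have [j gj] := coverg (iter m T x).
by exists (i, j).
Qed.

(** This is what rules out the default value of [min_subcover] on the joins of
a finite cover. *)
Lemma join_family (R : realType) (X : metricType R) (T : X -> X)
    (U : set (set X)) (n : nat) : finite_set U -> is_cover U ->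
  exists (I : finType) (f : I -> set X), covers_by (dynamical_join T U n) f.
Proof.
move=> [k Uk] coverU; have [g gcover] := card_cover_family Uk coverU.
elim: n => [|n [I [f fcover]]].
  by exists unit, (fun=> setT); rewrite dynamical_join0; split=> // x; exists tt.
exists ('I_k * I)%type; eexists; rewrite -add1n.
by apply: covers_by_joinD fcover; rewrite dynamical_join1; exact: gcover.
Qed.

Lemma min_subcover_joinD (R : realType) (X : metricType R) (T : X -> X)
    (U : set (set X)) (m n : nat) : finite_set U -> is_cover U ->
  (min_subcover (dynamical_join T U (m + n)) <=
   min_subcover (dynamical_join T U m) * min_subcover (dynamical_join T U n))%N.
Proof.
move=> finU coverU.
have [I [f /min_subcover_family[f' f'cover]]] := join_family T m finU coverU.
have [J [g /min_subcover_family[g' g'cover]]] := join_family T n finU coverU.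
have := min_subcover_le (covers_by_joinD f'cover g'cover).
by rewrite card_prod !card_ord.
Qed.

Lemma min_subcover_join_gt0 (R : realType) (X : metricType R) (T : X -> X)
    (U : set (set X)) (n : nat) (x : X) : finite_set U -> is_cover U ->
  (0 < min_subcover (dynamical_join T U n))%N.
Proof.
move=> finU coverU.
have [I [f fcover]] := join_family T n finU coverU.
have [g [_ /(_ x)[i _]]] := min_subcover_family fcover.
exact: leq_trans (ltn_ord i).
Qed.

(** * Existence of the limit defining the entropy of a cover *)

(** Fekete's lemma: the limit is the infimum of [a n / n] over [n > 0]. If
[a M / M] is close to the infimum, dividing [n] by [M] with remainder bounds
[a n / n] by [a M / M + C / n], where [C] does not depend on [n]. *)
Lemma fekete_nneg (R : realType) (a : nat -> R) :
  (forall n, 0 <= a n) -> (forall m n, a (m + n)%N <= a m + a n) ->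
  cvgn (fun n => a n / n%:R).
Proof.
move=> a0 aD.
(* The term a 0 is there for q = 0: nothing forces a 0 to vanish. *)
have aM q m : a (q * m)%N <= a 0%N + q%:R * a m.
  elim: q => [|q IH]; first by rewrite mul0n mul0r addr0.
  rewrite mulSn -natr1 mulrDl mul1r addrA [leRHS]addrC.
  by rewrite (le_trans (aD _ _))// lerD2l.
pose S := [set a n.+1 / n.+1%:R | n in [set: nat]].
have infS : has_inf S.
  split; first by exists (a 1%N / 1%:R), 0%N.
  by exists 0 => _ [n _ <-]; rewrite divr_ge0.
apply/cvg_ex; exists (inf S); apply/cvgrPdist_le => e e0.
have [_ [m _ <-]] := inf_adherent (divr_gt0 e0 (@ltr0n R 2)) infS.
set M := m.+1 => aM_lt.
pose C := a 0%N + a 0%N + M%:R * a 1%N.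
have C0 : 0 <= C by rewrite !addr_ge0// mulr_ge0.
have an n : a n.+1 / n.+1%:R <= a M / M%:R + C / n.+1%:R.
  rewrite ler_pdivrMr ?ltr0n// mulrDl divfK ?pnatr_eq0//.
  have le_q : (n.+1 %/ M)%:R * a M <= a M / M%:R * n.+1%:R.
    rewrite mulrC -mulrA ler_wpM2l// mulrC.
    by rewrite ler_pdivlMr ?ltr0n// -natrM ler_nat leq_divM.
  have le_r : (n.+1 %% M)%:R * a 1%N <= M%:R * a 1%N.
    by rewrite ler_wpM2r// ler_nat ltnW// ltn_mod.
  have := aM (n.+1 %% M)%N 1%N; rewrite muln1 => ar.
  have := aD (n.+1 %/ M * M)%N (n.+1 %% M)%N.
  rewrite -divn_eq => /le_trans; apply.
  rewrite /C; have := aM (n.+1 %/ M)%N M; lra.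
near=> n.
have [n' nE] : exists n', n = n'.+1.
  by exists n.-1; rewrite prednK//; near: n; exists 1%N.
have infn : inf S <= a n / n%:R.
  by rewrite nE; apply: ge_inf; [case: infS|exists n'].
rewrite ler0_norm ?subr_le0// opprB lerBlDr.
have Cn : C / n%:R <= e / 2.
  rewrite ler_pdivrMr ?nE ?ltr0n// -nE mulrC -ler_pdivrMr ?divr_gt0//.
  near: n; exact: nbhs_infty_ger.
have := an n'; rewrite -nE; lra.
Unshelve. all: by end_near. Qed.

(** The bound compares [lam ^ n] with the join of length [n.+1], as a path with
[n] edges visits [n.+1] vertices; the shift by one disappears in the limit. *)
Lemma entropy_cover_ge (R : realType) (X : metricType R) (T : X -> X)
    (U : set (set X)) (lam : R) : finite_set U -> is_cover U -> 1 <= lam -> X ->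
  (forall n, lam ^+ n <= (min_subcover (dynamical_join T U n.+1))%:R) ->
  ln lam <= entropy_cover T U.
Proof.
move=> finU coverU lam1 x lamN.
pose N n := min_subcover (dynamical_join T U n).
have N0 n : 0 < (N n)%:R :> R by rewrite ltr0n; exact: min_subcover_join_gt0.
have cvgN : cvgn (fun n => ln (N n)%:R / n%:R : R).
  apply: fekete_nneg => [n|m n].
    by rewrite ln_ge0// ler1n -(ltr0n R).
  rewrite -lnM ?posrE// -natrM ler_ln ?posrE ?ler_nat ?min_subcover_joinD//.
  by rewrite natrM mulr_gt0.
have lam0 : 0 < lam by rewrite (lt_le_trans _ lam1).
apply/ler_addgt0Pr => e e0; rewrite -lerBlDr.
apply: limr_ge => //; near=> n.
have [m nE] : exists m, n = m.+1.
  by exists n.-1; rewrite prednK//; near: n; exists 1%N.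
have n0 : 0 < n%:R :> R by rewrite nE.
have := lamN m; rewrite -nE -/(N n) -ler_ln ?posrE ?exprn_gt0// lnXn// => lnN.
rewrite ler_pdivlMr// mulrBl.
have en : ln lam <= e * n%:R.
  rewrite -ler_pdivrMl// mulrC; near: n; exact: nbhs_infty_ger.
move: lnN en; rewrite nE -natr1 -mulr_natr; lra.
Unshelve. all: by end_near. Qed.

Lemma entropy_cover_ge0 (R : realType) (X : metricType R) (T : X -> X)
    (U : set (set X)) :
  finite_set U -> is_cover U -> X -> 0 <= entropy_cover T U.
Proof.
move=> finU coverU x; rewrite -(@ln1 R); apply: entropy_cover_ge => // n.
by rewrite expr1n ler1n; exact: min_subcover_join_gt0.
Qed.

(** * Paths in a finite graph and eigenvalues *)

Fixpoint path_count (p : nat) (E : rel 'I_p) (n : nat) (i : 'I_p) : nat :=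
  if n is n'.+1 then (\sum_(j | E i j) path_count E n' j)%N else 1%N.

(** For a left eigenvector [v], the triangle inequality on the coordinate [j] of
[v *m A = lam *: v] bounds [|lam| |v j|] by the sum of [|v i|] over the
predecessors [i] of [j]. Hence the sum of [|v i| * path_count E n i] is
multiplied by at least [|lam|] when [n] increases by one. *)
Lemma eigenvalue_path_count (F : numFieldType) (p : nat) (E : rel 'I_p)
    (lam : F) (N n : nat) :
  eigenvalue (\matrix_(i, j) (E i j)%:R) lam ->
  (forall i, (path_count E n i <= N)%N) -> `|lam| ^+ n <= N%:R.
Proof.
move=> /eigenvalueP[v vE v0] leN.
have v_sum_gt0 : 0 < \sum_i `|v 0 i|.
  rewrite lt0r sumr_ge0// andbT psumr_eq0//; apply: contra v0 => /allP v0.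
  apply/eqP/rowP => i; rewrite mxE; apply/eqP.
  by rewrite -normr_eq0; apply: v0; rewrite mem_index_enum.
have grow : `|lam| ^+ n * (\sum_i `|v 0 i|) <=
    \sum_i `|v 0 i| * (path_count E n i)%:R.
  elim: {leN} n => [|n IH].
    by rewrite expr0 mul1r; under [leRHS]eq_bigr do rewrite mulr1.
  have -> : \sum_i `|v 0 i| * (path_count E n.+1 i)%:R =
     \sum_j (\sum_(i | E i j) `|v 0 i|) * (path_count E n j)%:R.
    under eq_bigr do rewrite /= natr_sum mulr_sumr.
    rewrite (exchange_big_dep xpredT)//=.
    by apply: eq_bigr => j _; rewrite mulr_suml.
  have col j : `|lam| * `|v 0 j| <= \sum_(i | E i j) `|v 0 i|.
    have /rowP/(_ j) := vE; rewrite !mxE -normrM => <-.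
    rewrite (le_trans (ler_norm_sum _ _ _))// [leRHS]big_mkcond /=.
    apply: ler_sum => i _; rewrite mxE.
    by case: (E i j); rewrite ?mulr1// mulr0 normr0.
  rewrite exprS -mulrA (le_trans (ler_wpM2l (normr_ge0 _) IH))// mulr_sumr.
  by apply: ler_sum => j _; rewrite mulrA ler_wpM2r.
rewrite -(ler_pM2r v_sum_gt0) (le_trans grow)// mulr_sumr.
by apply: ler_sum => i _; rewrite mulrC ler_wpM2r// ler_nat.
Qed.

(** * Counting itineraries in a coupled expansion *)

(** Induction on [n]. A member of the join of length [n.+2] is contained in the
preimage of a member [g k] of the join of length [n.+1]. Since [T] maps [L i]
over each successor [L j], the [g k] that meet [L j] cover [L j]; and no [g k]
meets two of the [L j], so that the subfamilies for different [j] are disjoint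
and their sizes add up. Covering only [L i], with only the indices in [D], is
what makes the induction hypothesis apply to these subfamilies. *)
Lemma path_count_le_cover (R : realType) (X : metricType R) (T : X -> X)
    (U : set (set X)) (p : nat) (E : rel 'I_p) (L : 'I_p -> set X) :
  (forall i, L i !=set0) ->
  (forall i j, E i j -> L j `<=` T @` L i) ->
  (forall B i j, U B -> B `&` L i !=set0 -> B `&` L j !=set0 -> i = j) ->
  forall n i (I : finType) (D : {set I}) (f : I -> set X),
  (forall k, k \in D -> dynamical_join T U n.+1 (f k)) ->
  L i `<=` \bigcup_(k in [set` D]) f k ->
  (path_count E n i <= #|D|)%N.
Proof.
move=> L0 LT sep; elim=> [|n IH] i I D f fD fcover.
  have [x /fcover[k kD _]] := L0 i.
  by rewrite /= card_gt0; apply/set0Pn; exists k.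
have /choice[g gP] k : exists C, k \in D ->
    dynamical_join T U n.+1 C /\ f k `<=` T @^-1` C.
  have [kD|/negbTE kD] := boolP (k \in D); last by exists set0.
  move: (fD k kD); rewrite -add1n dynamical_joinD => -[B _ [C joinC <-]].
  by exists C => _; split=> // x [].
have gsep k j1 j2 : k \in D ->
    g k `&` L j1 !=set0 -> g k `&` L j2 !=set0 -> j1 = j2.
  move=> /gP[+ _]; rewrite -add1n dynamical_joinD dynamical_join1.
  move=> [B UB [C _ <-]] [x [[Bx _] Lx]] [y [[By _] Ly]].
  by apply: sep UB _ _; [exists x|exists y].
pose meets j k := `[< g k `&` L j !=set0 >].
apply: (@leq_trans (\sum_(j | E i j) #|[set k in D | meets j k]|)%N).
  apply: leq_sum => j Eij; apply: (IH _ _ _ g) => [k|y Ly].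
    by rewrite inE => /andP[/gP[]].
  have [x Lx Txy] := LT i j Eij y Ly; have [k kD fkx] := fcover x Lx.
  have gky : g k y by have [_ /(_ x fkx)] := gP k kD; rewrite /= Txy.
  by exists k => //=; rewrite inE kD; apply/asboolP; exists y.
under eq_bigr do rewrite -sum1_card.
rewrite (exchange_big_dep (mem D)) /=; last first.
  by move=> j k _; rewrite inE => /andP[].
rewrite -sum1_card; apply: leq_sum => k kD.
rewrite sum1dep_card; apply/card_le1_eqP => j1 j2.
rewrite !inE kD /= => /andP[_ /asboolP m1] /andP[_ /asboolP m2].
exact/esym/(gsep k).
Qed.

(** * Separating the sets of a strict coupled expansion *)

Lemma closure_disjoint (R : realType) (X : metricType R) (B C : set X) :
  0 < set_dist B C -> closure B `&` closure C = set0.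
Proof.
move=> d0; apply/eqP/negPn/negP => /set0P[x [clB clC]].
have d20 : 0 < set_dist B C / 2 by rewrite divr_gt0.
have [y [By xy]] := clB _ (nbhsx_ballx x _ d20).
have [z [Cz xz]] := clC _ (nbhsx_ballx x _ d20).
have yz : mdist y z < set_dist B C.
  have : ball y (set_dist B C) z.
    by rewrite (splitr (set_dist B C)); apply: ball_triangle xz; exact: ball_sym.
  by rewrite ballEmdist.
have : set_dist B C <= mdist y z.
  apply: ge_inf; last by exists y => //; exists z.
  by exists 0 => _ [b _ [c _ <-]]; exact: mdist_ge0.
by rewrite leNgt yz.
Qed.

(** A point outside every member [V i] of the cover constructed here would lie
in two different closures: outside any [V i], it is in some [closure (L j)], and
being also outside [V j] it is in some [closure (L k)] with [k != j]. *)
Lemma separating_cover (R : realType) (X : metricType R) (p : nat)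
    (L : 'I_p -> set X) :
  (0 < p)%N -> (forall i j, i != j -> closure (L i) `&` closure (L j) = set0) ->
  exists2 U : set (set X), finite_open_cover U &
    forall B i j, U B -> B `&` L i !=set0 -> B `&` L j !=set0 -> i = j.
Proof.
move=> p0 disj.
pose V i := ~` \bigcup_(j in [set j | j != i]) closure (L j).
have notV i x : ~ V i x -> exists2 j, j != i & closure (L j) x.
  by move=> /contrapT[j ji Ljx]; exists j.
have VL i j : V i `&` L j !=set0 -> j = i.
  move=> [x [Vx Lx]]; apply/eqP/negPn/negP => ji; apply: Vx.
  by exists j => //; exact: subset_closure.
exists (range V); last first.
  by move=> _ i j [k _ <-] /VL -> /VL ->.
split; first by apply: finite_image; exact: finite_finset.
  move=> _ [i _ <-]; apply: closed_openC; apply: closed_bigcup => [|j _].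
    exact: finite_finset.
  exact: closed_closure.
apply/seteqP; split=> // x _; apply: contrapT => xV.
have nV i : ~ V i x by move=> Vx; apply: xV; exists (V i) => //; exists i.
have [j _ jx] := notV _ _ (nV (Ordinal p0)).
have [k kj kx] := notV _ _ (nV j).
by have : set0 x by rewrite -(disj _ _ kj).
Qed.

(** * The entropy bound *)

Theorem lemma6 (R : realType) (X : metricType R) (T : X -> X)
    (p : nat) (A : 'M[R]_p) (L : 'I_p -> set X) (lam : R) :
  topological_dynamical_system T ->
  (2 <= p)%N ->
  transition_matrix A ->
  is_maximal_eigenvalue A lam ->
  strictly_coupled_expanding T A L ->
  ((ln lam)%:E <= topological_entropy T)%E.
Proof.
move=> _ p2 [A01 _ _] [lam0 eigA _] [[L0 _ LT] dist_gt0].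
have p0 : (0 < p)%N by exact: ltnW.
have disj i j : i != j -> closure (L i) `&` closure (L j) = set0.
  by move=> ij; apply/closure_disjoint/dist_gt0.
have [U Ucover sep] := separating_cover p0 disj.
have [finU _ coverU] := Ucover.
have [x _] := L0 (Ordinal p0).
apply: (@le_trans _ _ (entropy_cover T U)%:E); last first.
  by apply: ereal_sup_ubound; exists U.
rewrite lee_fin; have [lam_lt1|lam_ge1] := ltP lam 1.
  by rewrite (@le_trans _ _ 0)// ?entropy_cover_ge0// ln_le0// ltW.
pose E := [rel i j | A i j == 1].
have AE : map_mx (real_complex R) A = \matrix_(i, j) (E i j)%:R.
  apply/matrixP => i j; rewrite !mxE /=.
  have [->|->] := A01 i j; first by rewrite rmorph0 eq_sym oner_eq0.
  by rewrite rmorph1 eqxx.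
apply: entropy_cover_ge => // n.
rewrite AE in eigA.
have [I [f fcover]] := join_family T n.+1 finU coverU.
have [g [Ug coverg]] := min_subcover_family fcover.
suff : `|real_complex R lam| ^+ n <=
    (min_subcover (dynamical_join T U n.+1))%:R.
  by rewrite ger0_norm ?lecR// -rmorphXn -(rmorph_nat (real_complex R)) lecR.
apply: eigenvalue_path_count eigA _ => i.
rewrite -[leqRHS]card_ord -cardsT.
apply: (@path_count_le_cover _ _ T U _ E L L0 _ sep n i _ _ g) => //.
  by move=> j k /eqP Ajk y Ly; apply: LT; exists k.
by move=> y _; have [k gk] := coverg y; exists k => //=; rewrite inE.
Qed.
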